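(* A Banach space (with the metric $d$ given by its norm) is Samuel realcompact if and only if it has finite dimension.
   Context: For a metric space $(X,d)$, $U_d(X)$ is the unital vector lattice of all real-valued uniformly continuous functions on $X$. The Samuel realcompactification $H(U_d(X))$ is the space of unital vector lattice homomorphisms $U_d(X)\to\mathbb{R}$ with the topology of pointwise convergence, in which $X$ is embedded as a dense subspace via evaluations at points; equivalently, it is the smallest realcompactification of $X$ to which every $f\in U_d(X)$ extends to a continuous real-valued function. (A realcompactification is a realcompact Tychonoff space containing $X$ as a dense subspace; $\alpha_1X\le\alpha_2X$ means that there is a continuous map $\alpha_2X\to\alpha_1X$ leaving $X$ pointwise fixed.) $X$ is Samuel realcompact if $X=H(U_d(X))$. *)

(* Defs.v *)
From HB Require Import structures.
From mathcomp Require Import all_boot all_order all_algebra lra.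
From mathcomp Require Import all_classical all_reals all_analysis.

Set Implicit Arguments.
Unset Strict Implicit.
Unset Printing Implicit Defensive.
Import Order.TTheory GRing.Theory Num.Theory.
Import numFieldNormedType.Exports.
Local Open Scope classical_set_scope.
Local Open Scope ring_scope.

(* Only the balls of the metric matter below. A [normedModType] is not a     *)
(* [metricType] in the library, but its [pseudoMetricType] structure has the *)
(* open balls of the norm as its balls, hence the choice of the latter here. *)
Section UniformlyContinuousFunctions.
Context {R : realType} (X : pseudoMetricType R).

Definition ucont : {pred X -> R} := fun f => `[< unif_continuous f >].

Lemma ucontP (f : X -> R) :
  reflect (forall e, 0 < e -> exists2 d, 0 < d &
             forall x y, ball x d y -> `|f x - f y| < e)
          (f \in ucont).
Proof.
apply: (iffP (asboolP _)) => [/unif_continuousP fuc e /fuc[d d0 fd]|fuc].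
  by exists d => // x y; exact: (fd (x, y)).
apply/unif_continuousP => e /fuc[d d0 fd].
by exists d => // -[x y]; exact: fd.
Qed.

Lemma ucont_submod_closed : submod_closed ucont.
Proof.
split=> [|a f g /ucontP fuc /ucontP guc].
  by apply/ucontP => e e0; exists 1 => // x y _; rewrite subrr normr0.
apply/ucontP => e e0.
have e2a : 0 < e / 2 / (`|a| + 1) by rewrite !divr_gt0// ltr_wpDl.
have e2 : 0 < e / 2 by rewrite divr_gt0.
have [d1 d10 fd] := fuc _ e2a; have [d2 d20 gd] := guc _ e2.
exists (Num.min d1 d2) => [|x y xy]; first by rewrite lt_min d10.
have /fd fxy : ball x d1 y by apply: le_ball xy; rewrite ge_min lexx.
have /gd gxy : ball x d2 y by apply: le_ball xy; rewrite ge_min lexx orbT.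
rewrite [_ x](_ : _ = a * f x + g x)// [_ y](_ : _ = a * f y + g y)//.
rewrite opprD addrACA -mulrBr (splitr e).
apply: le_lt_trans (ler_normD _ _) _; apply: ler_ltD gxy.
rewrite normrM; apply: (@le_trans _ _ ((`|a| + 1) * `|f x - f y|)).
  by rewrite ler_wpM2r// lerDl.
by rewrite mulrC -ler_pdivlMr ?ltr_wpDl// ltW.
Qed.

HB.instance Definition _ := GRing.isSubmodClosed.Build R (X -> R) ucont
  ucont_submod_closed.

Lemma ucont_meet_join_closed :
  {in ucont &, forall f g, Order.meet f g \in ucont} /\
  {in ucont &, forall f g, Order.join f g \in ucont}.
Proof.
have gen (op : R -> R -> R) (opd : forall a b c d,
    `|op a b - op c d| <= `|a - c| + `|b - d|) (h f g : X -> R) :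
  (forall x, h x = op (f x) (g x)) ->
  f \in ucont -> g \in ucont -> h \in ucont.
  move=> hE /ucontP fuc /ucontP guc; apply/ucontP => e e0.
  have e2 : 0 < e / 2 by rewrite divr_gt0.
  have [d1 d10 fd] := fuc _ e2; have [d2 d20 gd] := guc _ e2.
  exists (Num.min d1 d2) => [|x y xy]; first by rewrite lt_min d10.
  have /fd fxy : ball x d1 y by apply: le_ball xy; rewrite ge_min lexx.
  have /gd gxy : ball x d2 y by apply: le_ball xy; rewrite ge_min lexx orbT.
  by rewrite !hE (splitr e); apply: le_lt_trans (opd _ _ _ _) (ltrD _ _).
split=> f g; [apply: (gen Num.min) | apply: (gen Num.max)] => //.
- move=> a b c d; case: (leP a b) => ?; case: (leP c d) => ?;
  rewrite ler_norml; case: (ler0P (a - c)) => ?; case: (ler0P (b - d)) => ?;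
  apply/andP; split; lra.
- by move=> x; rewrite meetfE meetEtotal.
- move=> a b c d; case: (leP a b) => ?; case: (leP c d) => ?;
  rewrite ler_norml; case: (ler0P (a - c)) => ?; case: (ler0P (b - d)) => ?;
  apply/andP; split; lra.
- by move=> x; rewrite joinfE joinEtotal.
Qed.

HB.instance Definition _ := Order.isLatticeClosed.Build _ (X -> R) ucont
  ucont_meet_join_closed.1 ucont_meet_join_closed.2.

Record ucfun : Type := UCFun { ucfun_val :> X -> R; _ : ucfun_val \in ucont }.

HB.instance Definition _ := [isSub for ucfun_val].
HB.instance Definition _ := [Choice of ucfun by <:].
HB.instance Definition _ := [SubChoice_isSubLmodule of ucfun by <:].
HB.instance Definition _ :=
  [SubChoice_isSubLattice of ucfun by <: with FunOrder.fun_display].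

Lemma ucont_cst (c : R) : cst c \in ucont.
Proof. by apply/ucontP => e e0; exists 1 => // x y _; rewrite subrr normr0. Qed.

Definition ucfun1 : ucfun := UCFun (ucont_cst 1).

End UniformlyContinuousFunctions.

Arguments ucfun {R} X.
Arguments ucfun1 {R} X.

Section SamuelRealcompactification.
Context {R : realType} (X : pseudoMetricType R).

Record unital_vl_hom (phi : ucfun X -> R) : Prop := UnitalVLHom {
  uvlh_linear : scalar phi ;
  uvlh_one : phi (ucfun1 X) = 1 ;
  uvlh_meet : {morph phi : f g / Order.meet f g >-> Order.meet f g} ;
  uvlh_join : {morph phi : f g / Order.join f g >-> Order.join f g} }.

(* The coercion of sets to types equips this set of functionals with the *)
(* topology induced by that of pointwise convergence.                    *)
Definition samuel_realcompactification : set {ptws ucfun X -> R} :=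
  [set phi | unital_vl_hom phi].

Lemma unital_vl_hom_ev (x : X) : unital_vl_hom (fun f : ucfun X => f x).
Proof. by split. Qed.

Definition samuel_ev (x : X) : samuel_realcompactification :=
  SigSub (mem_set (unital_vl_hom_ev x)).

(* [X = H(U_d(X))] as extensions of [X]: the canonical map of [X] into its *)
(* realcompactification is a homeomorphism.                                *)
Definition samuel_realcompact : Prop :=
  exists g : samuel_realcompactification -> X,
    [/\ cancel samuel_ev g, cancel g samuel_ev,
        continuous samuel_ev & continuous g].

End SamuelRealcompactification.

(* [Vector.axiom n V] is a linear bijection from [V] to the space of row *)
(* vectors of size [n].                                                 *)
Definition finite_dimensional (K : fieldType) (V : lmodType K) : Prop :=
  exists n : nat, inhabited (Vector.axiom n V).

(* Main.v *)
Require Import Defs.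
From mathcomp Require Import all_boot all_order all_algebra.
From mathcomp Require Import all_classical all_reals all_analysis.
From mathcomp Require Import lra.

(** Both sides of the equivalence say that the closed balls of [X] are compact.

    If they are, let [phi] be a unital vector lattice homomorphism. Every
    function comes close to its value under [phi] at some point of [X]
    ([uvlh_approx]), and so do finitely many functions at once, since the maximum
    of their deviations is again one function. Taking the norm among them keeps
    these points in a fixed ball, whose compactness gives a point where all
    functions take exactly their values under [phi] ([uvlh_ev]). So every
    homomorphism is an evaluation, and the distance functions make the correspondence a
    homeomorphism ([samuel_realcompact_compact_balls]).

    Conversely, a uniformly continuous function on a normed space is bounded on
    the unit ball ([ucfun_bounded_ball]), so that each ultrafilter on the ball
    yields a homomorphism, the limit along the ultrafilter. If this homomorphism
    is the evaluation at [x], the ultrafilter converges to [x]. Hence in a Samuel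
    realcompact normed space the unit ball is compact
    ([samuel_realcompact_unit_ball]).

    It remains to relate compact balls to the dimension: in finite dimension a
    basis identifies [X] with a space of row vectors by a linear map bounded below
    ([finite_dimensional_compact_balls]), and a compact unit ball forces finite
    dimension by Riesz's theorem ([compact_unit_ball_finite_dimensional]). *)

Set Implicit Arguments.
Unset Strict Implicit.
Unset Printing Implicit Defensive.
Import Order.TTheory GRing.Theory Num.Theory.
Import numFieldNormedType.Exports.
Local Open Scope classical_set_scope.
Local Open Scope ring_scope.

(** * Homomorphisms are approximated by points *)

Section UcfunOperations.
Context {R : realType} {X : pseudoMetricType R}.
Implicit Types (f g : ucfun X) (phi : ucfun X -> R).

Definition ucfun_cst (c : R) : ucfun X := UCFun (ucont_cst X c).

Lemma ucfun_eqP f g : (forall x, f x = g x) -> f = g.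
Proof. by move=> fg; apply: val_inj; apply/funext. Qed.

Lemma ucfun_linE a f g x : (a *: f + g) x = a * f x + g x.
Proof. by []. Qed.

Lemma ucfun_meetE f g x : (Order.meet f g : ucfun X) x = Num.min (f x) (g x).
Proof. by rewrite -meetEtotal. Qed.

Lemma ucfun_joinE f g x : (Order.join f g : ucfun X) x = Num.max (f x) (g x).
Proof. by rewrite -joinEtotal. Qed.

Lemma ucfun_continuous f : continuous (f : X -> R).
Proof.
move=> x; apply/cvgrPdist_lt => e /(ucontP _ (valP f))[d d0 fd].
by apply/nbhs_ballP; exists d => // y; exact: fd.
Qed.

Lemma uvlh_cst phi c : unital_vl_hom phi -> phi (ucfun_cst c) = c.
Proof.
move=> [phil phi1 _ _].
rewrite (_ : ucfun_cst c = (c - 1) *: ucfun1 X + ucfun1 X); last first.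
  by apply: ucfun_eqP => x; rewrite ucfun_linE /= mulr1 subrK.
by rewrite phil phi1 mulr1 subrK.
Qed.

(** The function [|f - c|], written with the lattice operations so that
    homomorphisms can be computed on it. *)
Definition ucfun_dev (c : R) f : ucfun X :=
  Order.join (-1 *: ucfun_cst c + f) (-1 *: f + ucfun_cst c).

Lemma ucfun_devE c f x : ucfun_dev c f x = `|f x - c|.
Proof.
rewrite ucfun_joinE !ucfun_linE /= !mulN1r addrC [- f x + c]addrC.
by rewrite -[c - f x]opprB maxrN.
Qed.

Lemma uvlh_dev phi c f : unital_vl_hom phi ->
  phi (ucfun_dev c f) = `|phi f - c|.
Proof.
move=> phiH; have [phil _ _ phij] := phiH.
rewrite phij !phil uvlh_cst// joinEtotal !mulN1r addrC [- phi f + c]addrC.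
by rewrite -[c - phi f]opprB maxrN.
Qed.

(** If [|f - phi f|] stayed above [e], its meet with the constant [e] would be
    that constant, which [phi] sends to [e]; but [phi] also sends this meet to
    [min 0 e = 0]. *)
Lemma uvlh_approx phi f e : unital_vl_hom phi -> 0 < e ->
  exists x, `|f x - phi f| < e.
Proof.
move=> phiH e0; apply: contrapT => /forallNP far.
have [_ _ phim _] := phiH.
have : phi (Order.meet (ucfun_dev (phi f) f) (ucfun_cst e)) = e.
  rewrite -[RHS](uvlh_cst e phiH); congr phi; apply: ucfun_eqP => x.
  rewrite ucfun_meetE ucfun_devE /=; apply/min_idPr.
  by rewrite leNgt; apply/negP; exact: far.
rewrite phim uvlh_dev// uvlh_cst// subrr normr0 meetEtotal (min_idPl (ltW e0)).
by move=> e00; rewrite -e00 ltxx in e0.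
Qed.

(** The sets on which [f] is close to [phi f] generate a proper filter. One of
    them lies in the compact set, so the filter has a cluster point, and there
    every [f] takes the value [phi f]. *)
Lemma uvlh_ev phi f0 : unital_vl_hom phi ->
  compact [set x | f0 x <= phi f0 + 1] -> exists x, forall f, phi f = f x.
Proof.
move=> phiH K; have [_ _ _ phij] := phiH.
pose D : set (ucfun X * R) := [set fe | 0 < fe.2].
pose B (fe : ucfun X * R) := [set x | `|fe.1 x - phi fe.1| < fe.2].
have FF : ProperFilter (filter_from D B).
  apply: filter_from_proper; last first.
    by move=> [f e] /= e0; exact: uvlh_approx.
  apply: filter_from_filter; first by exists (f0, 1) => /=; rewrite /D/=.
  move=> [f e] [g d] /= e0 d0.
  (* Closeness to two prescribed values is closeness of the single function
     [h] to [phi h = 0]. *)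
  pose h := Order.join (ucfun_dev (phi f) f) (ucfun_dev (phi g) g).
  exists (h, Num.min e d); first by rewrite /D /= lt_min e0.
  have phih : phi h = 0.
    by rewrite phij !uvlh_dev// !subrr normr0 joinEtotal maxxx.
  move=> x; rewrite /B /mkset [`|_|]/(`|h x - phi h|) phih subr0 ucfun_joinE.
  rewrite !ucfun_devE => /ltr_normlW /=.
  by rewrite gt_max !lt_min => /andP[/andP[-> _] /andP[_ ->]].
have [|x [_ clx]] := K (filter_from D B) FF.
  exists (f0, 1) => /=; first by rewrite /D/=.
  by move=> x; rewrite /B /= => /ltr_normlW; rewrite ltrBlDl => /ltW.
exists x => f; apply/eqP; rewrite -subr_eq0 -normr_le0 leNgt; apply/negP.
set e := `|phi f - f x| => e0.
have [||y []] := clx (B (f, e / 2)) (ball (f x) (e / 2) \o f).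
- by exists (f, e / 2) => //=; rewrite /D/= divr_gt0.
- by apply: (ucfun_continuous (nbhsx_ballx _ _ _)); rewrite divr_gt0.
rewrite /B /= -ball_normE /= => yphi fxy.
suff : e < e by rewrite ltxx.
rewrite [ltRHS]splitr (le_lt_trans (ler_distD (f y) _ _))// ltrD//.
  by rewrite distrC.
by rewrite distrC.
Qed.

End UcfunOperations.

(** * Compact balls imply Samuel realcompactness *)

Section CompactBalls.
Context {R : realType} {X : normedModType R}.

Lemma ucont_dist (a : X) : (fun x : X => `|x - a| : R) \in @ucont R X.
Proof.
apply/ucontP => e e0; exists e => // x y; rewrite -ball_normE /= => xy.
by apply: le_lt_trans xy; rewrite (le_trans (ler_dist_dist _ _))// opprB subrKA.
Qed.

Definition ucfun_dist (a : X) : ucfun X := UCFun (ucont_dist a).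

Lemma samuel_ev_continuous : continuous (@samuel_ev R X).
Proof.
apply: continuous_comp_initial => x; apply/cvg_sup => f.
apply: (@continuous_comp_initial _ _ _ (fun g : {ptws ucfun X -> R} => g f)).
exact: ucfun_continuous.
Qed.

(** The function [|x|] has the closed balls as sublevel sets, so every
    homomorphism is an evaluation. The distance functions [|x - a|] then show
    that the point is unique and depends continuously on the homomorphism:
    convergence to [g phi] only has to be tested on [|x - g phi|]. *)
Lemma samuel_realcompact_compact_balls :
  (forall r : R, compact [set x : X | `|x| <= r]) -> samuel_realcompact X.
Proof.
move=> K.
have ev (phi : @samuel_realcompactification R X) :
    exists x : X, forall f, \val phi f = f x.
  have phiH : unital_vl_hom (\val phi) := set_mem (valP phi).
  apply: (uvlh_ev (f0 := ucfun_dist 0)) => //.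
  have -> : [set x | ucfun_dist 0 x <= \val phi (ucfun_dist 0) + 1] =
      [set x : X | `|x| <= \val phi (ucfun_dist 0) + 1].
    by apply/seteqP; split=> x /=; rewrite subr0.
  exact: K.
have [g gE] := choice ev; exists g; split.
- move=> x; apply/eqP; rewrite -subr_eq0 -normr_eq0.
  by have := gE (samuel_ev x) (ucfun_dist x); rewrite /= subrr normr0 => <-.
- by move=> phi; apply: val_inj; apply/funext => f; rewrite /= gE.
- exact: samuel_ev_continuous.
- move=> phi U /nbhs_ballP[e e0 gphiU].
  have evc : continuous (fun psi : @samuel_realcompactification R X =>
      \val psi (ucfun_dist (g phi))).
    move=> psi; apply: (@continuous_comp _ _ _
      (set_val : @samuel_realcompactification R X -> _)
      (proj (ucfun_dist (g phi)))); first exact: initial_continuous.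
    exact: proj_continuous.
  apply: (@filterS _ _ (nbhs_filter phi) _ _ _
    (evc phi _ (nbhsx_ballx _ _ e0))) => psi /=.
  rewrite !gE /= subrr normr0 -ball_normE /= sub0r normrN normr_id => psie.
  by apply: gphiU; rewrite -ball_normE /= distrC.
Qed.

End CompactBalls.

(** * Limits along ultrafilters as homomorphisms *)

Section LimitHomomorphisms.

Lemma ultra_compact_cvg (T : Type) (Y : topologicalType) (f : T -> Y)
    (U : set_system T) (K : set Y) :
  UltraFilter U -> compact K -> U (f @^-1` K) -> exists l : Y, f @ U --> l.
Proof.
move=> UU cK UK; have [l [_ cll]] := cK (f @ U) _ UK.
exists l => V Vl; have [//|UnV] := in_ultra_setVsetC (f @^-1` V) UU.
by have [y []] := cll (~` V) V UnV Vl.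
Qed.

(** A limit along a filter commutes with the vector space and lattice
    operations, as these are continuous on the real line. *)
Lemma uvlh_lim (R : realType) (X : pseudoMetricType R) (F : set_system X)
    (phi : ucfun X -> R) : ProperFilter F ->
  (forall f : ucfun X, f @ F --> phi f) -> unital_vl_hom phi.
Proof.
move=> FF phiF.
have uniq (f : ucfun X) (l : R) : f @ F --> l -> phi f = l.
  by move=> fl; exact: (cvg_unique _ (phiF f) fl).
split.
- move=> a f g; apply: uniq.
  exact: (cvgD (cvgMl_tmp (a := a) (phiF f)) (phiF g)).
- by apply: uniq; exact: cvg_cst.
- move=> f g; apply: uniq; rewrite meetEtotal.
  rewrite (_ : ucfun_val _ = fun x => Num.min (f x) (g x)); last first.
    by apply/funext => x; rewrite ucfun_meetE.
  exact: (@continuous2_cvg _ R R R F _ f g Num.min _ _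
    (@min_continuous _ R (phi f, phi g)) (phiF f) (phiF g)).
- move=> f g; apply: uniq; rewrite joinEtotal.
  rewrite (_ : ucfun_val _ = fun x => Num.max (f x) (g x)); last first.
    by apply/funext => x; rewrite ucfun_joinE.
  exact: (@continuous2_cvg _ R R R F _ f g Num.max _ _
    (@max_continuous _ R (phi f, phi g)) (phiF f) (phiF g)).
Qed.

Lemma samuel_realcompact_ev (R : realType) (X : pseudoMetricType R)
    (phi : ucfun X -> R) : samuel_realcompact X -> unital_vl_hom phi ->
  exists x, forall f, phi f = f x.
Proof.
move=> [g [_ gK _ _]] phiH.
pose p : @samuel_realcompactification R X := SigSub (mem_set phiH).
by exists (g p) => f; rewrite -[LHS]/(\val p f) -[in LHS](gK p).
Qed.

Context {R : realType} {X : normedModType R}.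

(** The segment from [0] to [x] is cut into a number of steps shorter than the
    modulus [d] of [f] for the error [1]. This number does not depend on [x], and
    [f] moves by less than [1] in each step. *)
Lemma ucfun_bounded_ball (f : ucfun X) :
  exists M : R, forall x : X, `|x| <= 1 -> `|f x| <= M.
Proof.
have [d d0 fd] := ucontP _ (valP f) _ (ltr01 : 0 < 1 :> R).
have [n dn] : exists n : nat, n.+1%:R^-1 < d.
  have [n _ /(_ n (leqnn n)) nd] := near_infty_natSinv_lt (PosNum d0).
  by exists n.
exists (`|f 0| + n.+1%:R) => x x1.
pose y k := ((k%:R / n.+1%:R) *: x).
have step k : `|f (y k) - f 0| <= k%:R.
  elim: k => [|k IH]; first by rewrite /y mul0r scale0r subrr normr0.
  rewrite (le_trans (ler_distD (f (y k)) _ _))// -natr1 addrC lerD//.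
  apply/ltW/fd; rewrite -ball_normE /= -scalerBl -mulrBl -natr1 addrAC subrr.
  rewrite add0r mul1r normrZ ger0_norm ?invr_ge0//.
  by rewrite (le_lt_trans _ dn)// ler_piMr// invr_ge0.
have := step n.+1; rewrite /y divff// scale1r => fxn.
by rewrite -(subrK (f 0) (f x)) (le_trans (ler_normD _ _))// addrC lerD2l.
Qed.

(** Along an ultrafilter on the ball every uniformly continuous function has a
    limit, since it is bounded there. Taking these limits is a homomorphism,
    hence the evaluation at some [x]. In particular [|y - x|] tends to
    [|x - x| = 0], so the ultrafilter converges to [x]. *)
Lemma samuel_realcompact_unit_ball :
  samuel_realcompact X -> compact [set x : X | `|x| <= 1].
Proof.
move=> SX; rewrite compact_ultra => U UU UB.
have lim (f : ucfun X) : exists l : R, f @ U --> l.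
  have [M fM] := ucfun_bounded_ball f.
  apply: (@ultra_compact_cvg _ R f U `[- M, M] UU (@segment_compact _ _ _)).
  by apply: filterS UB => x /fM; rewrite /= in_itv /= ler_norml.
have [phi phiU] := choice lim.
have [x phix] := samuel_realcompact_ev SX (uvlh_lim _ phiU).
have distU a : (fun y : X => `|y - a|) @ U --> `|x - a|.
  by have := phiU (ucfun_dist a); rewrite phix.
exists x; split=> /=.
  have := distU 0; rewrite subr0 => /cvgr_to_le; apply.
  by apply: filterS UB => y /=; rewrite subr0.
apply/cvgrPdist_lt => e e0.
have /cvgrPdist_lt/(_ e e0) := distU x; apply: filterS => y.
by rewrite subrr normr0 sub0r normrN normr_id distrC.
Qed.

End LimitHomomorphisms.

(** * Compact balls in finite dimension *)

Section LinearCombinations.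
Context {R : realType} {X : normedModType R}.

(** With [e] fixed this is the linear map from row vectors to [X] that sends
    the standard basis to [e]; compactness is transported along it. *)
Definition lincomb n (e : 'I_n -> X) (c : 'rV[R]_n) : X :=
  \sum_i c ord0 i *: e i.

Lemma lincomb_linear n (e : 'I_n -> X) : linear (lincomb e).
Proof.
move=> a c d; rewrite /lincomb scaler_sumr -big_split /=.
by apply: eq_bigr => i _; rewrite !mxE scalerDl scalerA.
Qed.

Lemma lincomb0 n (e : 'I_n -> X) : lincomb e 0 = 0.
Proof. by apply: big1 => i _; rewrite mxE scale0r. Qed.

Lemma lincombZ n (e : 'I_n -> X) a c : lincomb e (a *: c) = a *: lincomb e c.
Proof. by have := lincomb_linear e a c 0; rewrite lincomb0 !addr0. Qed.

Lemma lincomb_delta n (e : 'I_n -> X) i : lincomb e (delta_mx ord0 i) = e i.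
Proof.
rewrite /lincomb (bigD1 i)//= mxE !eqxx scale1r big1 ?addr0// => j /negPf ji.
by rewrite mxE ji andbF scale0r.
Qed.

Lemma lincomb_continuous n (e : 'I_n -> X) : continuous (lincomb e).
Proof.
apply: (continuous_big (op := +%R)) => [|i _ c]; first exact: add_continuous.
by apply: cvgZr_tmp; [exact: nbhs_filter|exact: coord_continuous].
Qed.

(** On the unit sphere of the row vectors, which is compact, [|lincomb e c|]
    has a positive minimum [m] because [e] is free. By homogeneity
    [m * |c| <= |lincomb e c|] for all [c], so the set is bounded. *)
Lemma lincomb_compact_ball n (e : 'I_n -> X) (r : R) :
  (forall c, lincomb e c = 0 -> c = 0) ->
  compact [set c | `|lincomb e c| <= r].
Proof.
move=> e_free; pose S := [set c : 'rV[R]_n | `|c| = 1].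
have normT : continuous (fun c : 'rV[R]_n => `|lincomb e c|).
  move=> c; apply: continuous_comp; first exact: lincomb_continuous.
  exact: norm_continuous.
have [m m0 Tm] : exists2 m : R, 0 < m & forall c, S c -> m <= `|lincomb e c|.
  (* The sphere is empty exactly when [n = 0]; any [m] will then do. *)
  have [S0|/set0P Sn0] := eqVneq S set0.
    by exists 1 => // c; rewrite S0.
  have cS : compact S.
    apply: bounded_closed_compact.
      by exists 1; split=> // y y1 c /= ->; exact: ltW.
    apply: (@preimage_closed _ _ (fun c : 'rV[R]_n => `|c|) [set 1]).
      by move=> c _; exact: norm_continuous.
    exact: closed_eq.
  have [c /set_mem Sc minc] := EVT_min_rV Sn0 cS (continuous_subspaceT normT).
  exists `|lincomb e c|; last by move=> d Sd; apply: minc; exact: mem_set.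
  rewrite normr_gt0; apply: contra_eq_neq Sc => /e_free ->.
  by rewrite normr0 eq_sym oner_neq0.
apply: bounded_closed_compact; last first.
  apply: (@preimage_closed _ _ (fun c => `|lincomb e c|) [set x | x <= r]).
    by move=> c _; exact: normT.
  exact: closed_le.
exists (r / m); split=> [|M rM c /= cr]; first exact: num_real.
apply: le_trans (ltW rM).
have [->|c0] := eqVneq c 0.
  by rewrite normr0 divr_ge0 ?(ltW m0)// (le_trans _ cr).
rewrite ler_pdivlMr// mulrC (le_trans _ cr)//.
have nc0 : 0 < `|c| by rewrite normr_gt0.
have /Tm : S (`|c|^-1 *: c) by rewrite /S /= normrZV// unitfE gt_eqF.
by rewrite lincombZ normrZ ger0_norm ?invr_ge0// ler_pdivlMl// mulrC.
Qed.

(** The balls are the images, under the continuous map [lincomb e] of a basis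
    [e], of the compact sets of the previous lemma. *)
Lemma finite_dimensional_compact_balls : finite_dimensional X ->
  forall r : R, compact [set x : X | `|x| <= r].
Proof.
move=> [n [[v2r v2r_lin [r2v v2rK r2vK]]]] r.
pose e i := r2v (delta_mx ord0 i).
have v2r0 : v2r 0 = 0.
  by have := v2r_lin (-1) 0 0; rewrite !scaler0 addr0 scaleN1r addNr.
have v2rT c : v2r (lincomb e c) = c.
  have v2rsum (s : seq 'I_n) :
      v2r (\sum_(i <- s) c ord0 i *: e i) =
      \sum_(i <- s) c ord0 i *: delta_mx ord0 i.
    elim: s => [|i s IH]; first by rewrite !big_nil.
    by rewrite !big_cons v2r_lin IH r2vK.
  by rewrite /lincomb v2rsum [RHS]row_sum_delta.
have -> : [set x : X | `|x| <= r] = lincomb e @` [set c | `|lincomb e c| <= r].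
  have Tv2r x : lincomb e (v2r x) = x by apply: (can_inj v2rK); rewrite v2rT.
  apply/seteqP; split=> [x xr|_ [c cr <-]//]; exists (v2r x) => //=.
  by rewrite Tv2r.
apply: continuous_compact.
  by apply: continuous_subspaceT; exact: lincomb_continuous.
by apply: lincomb_compact_ball => c c0; rewrite -(v2rT c) c0.
Qed.

End LinearCombinations.

(** * Riesz's theorem on compact unit balls *)

Section CompactUnitBall.
Context {R : realType} {X : normedModType R}.

(** A spanning family of minimal size is free: a nontrivial relation would
    express one of its members through the others, leaving a smaller one. *)
Lemma spanning_finite_dimensional n (e : 'I_n -> X) :
  (forall x, exists c, x = lincomb e c) -> finite_dimensional X.
Proof.
move=> e_span.
pose spans k := `[< exists d : 'I_k -> X, forall x, exists c,
  x = lincomb d c >].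
have [|m /asboolP[d d_span] m_min] := @ex_minnP spans.
  by exists n; apply/asboolP; exists e.
have d_free c : lincomb d c = 0 -> c = 0.
  apply: contraPP => /eqP c0 Tc0.
  have [i ci0] : exists i, c ord0 i != 0.
    apply: contrapT => /forallNP ci; apply/negP: c0; apply/negPn/eqP/rowP => i.
    by rewrite mxE; apply/eqP/negPn/negP/ci.
  case: m => [|m] in d d_span m_min c c0 Tc0 i ci0 *; first by case: i ci0.
  suff : (m.+1 <= m)%N by rewrite ltnn.
  apply: m_min; apply/asboolP; exists (fun j => d (lift i j)) => x.
  have [b ->] := d_span x.
  (* Subtracting a multiple of the relation [c] cancels the [i]-th coefficient. *)
  pose b' := b - (b ord0 i / c ord0 i) *: c.
  have -> : lincomb d b = lincomb d b'.
    rewrite /b' addrC -scaleNr lincomb_linear Tc0 scaler0 add0r//.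
  exists (\row_j b' ord0 (lift i j)).
  rewrite /lincomb (bigD1_ord i)//= !mxE divfK// subrr scale0r add0r.
  by apply: eq_bigr => j _; rewrite mxE.
have [v2r v2rK] := choice d_span; exists m; constructor.
have Tinj : injective (lincomb d).
  move=> a b Tab; apply/eqP; rewrite -subr_eq0; apply/eqP/d_free.
  by rewrite addrC -scaleN1r lincomb_linear Tab scaleN1r addNr.
exists v2r.
  by move=> a x y; apply: Tinj; rewrite -v2rK lincomb_linear -!v2rK.
by exists (lincomb d) => // c; apply: Tinj; rewrite -v2rK.
Qed.

(** Riesz's theorem. Let balls of radius [1/2] with centers [e] cover the unit
    ball. Correcting the error [x - e i] again and again, each time rescaled to
    the unit ball, writes [x] up to [2^-k] as a combination of [e] whose
    coefficients are at most [1 + 1/2 + 1/4 + ... = 2]. The combinations with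
    coefficients in [[-2, 2]] form a compact, hence closed, set, so [x] itself is
    one of them. *)
Lemma compact_unit_ball_finite_dimensional :
  compact [set x : X | `|x| <= 1] -> finite_dimensional X.
Proof.
move=> cB; have := cB; rewrite compact_cover.
move=> /(_ X setT (fun a : X => ball a 2^-1)) [a _|x _|D _ BD].
- exact: ball_open.
- by exists x => //; apply: ballxx; rewrite invr_gt0.
pose s := finmap.enum_fset D.
pose e (i : 'I_(size s)) : X := nth 0 s i.
have near_e x : `|x| <= 1 -> exists i, `|x - e i| <= 2^-1.
  move=> /BD[a /= aD]; rewrite -ball_normE /= => ax.
  have iD : (index a s < size s)%N by rewrite index_mem.
  by exists (Ordinal iD); rewrite /e /= nth_index// distrC ltW.
pose Q := [set c : 'rV[R]_(size s) | forall i,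
  `[(-2 : R), 2]%classic (c ord0 i)].
have approx k x : `|x| <= 1 -> exists2 c, Q c & `|x - lincomb e c| <= 2^-1 ^+ k.
  elim: k x => [|k IH] x x1.
    exists 0; last by rewrite lincomb0 subr0 expr0.
    by move=> i; rewrite mxE /= in_itv /= lerNl oppr0 !ler0n.
  have [i xi] := near_e x x1.
  (* The error [x - e i] is at most [1/2], so its double is in the unit ball. *)
  have [|c Qc yc] := IH (2%:R *: (x - e i)).
    by rewrite normrZ ger0_norm// -ler_pdivlMl// mulr1.
  exists (2^-1 *: c + delta_mx ord0 i).
    move=> j; have := Qc j; rewrite !mxE /= !in_itv ?eqxx /=.
    by case: (j == i) => /=; lra.
  rewrite lincomb_linear lincomb_delta opprD addrCA addrC.
  rewrite exprS -[X in `|X|](_ : 2^-1 *: (2%:R *: (x - e i) - lincomb e c) = _).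
    by rewrite normrZ ger0_norm ?invr_ge0// ler_wpM2l// invr_ge0.
  by rewrite scalerBr scalerA mulVf// scale1r addrC.
have TQ : closed (lincomb e @` Q).
  apply: compact_closed; first exact: norm_hausdorff.
  apply: continuous_compact.
    by apply: continuous_subspaceT; exact: lincomb_continuous.
  by apply: (@rV_compact R _ (fun=> `[-2, 2]%classic)) => i;
     exact: segment_compact.
have B_TQ x : `|x| <= 1 -> exists c, x = lincomb e c.
  move=> x1; suff [c _ <-] : (lincomb e @` Q) x by exists c.
  apply: TQ => V /nbhs_ballP[r r0 xV].
  have [k kr] : exists k, (2^-1 : R) ^+ k < r.
    have [k _ /(_ k (leqnn k))] := near_infty_natSinv_expn_lt (PosNum r0).
    by rewrite div1r => kr; exists k; rewrite exprVn.
  have [c Qc xc] := approx k x x1; exists (lincomb e c).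
  split; first by exists c.
  by apply: xV; rewrite -ball_normE /=; exact: le_lt_trans kr.
apply: (@spanning_finite_dimensional _ e) => x.
have [->|x0] := eqVneq x 0; first by exists 0; rewrite lincomb0.
have [|c xc] := B_TQ (`|x|^-1 *: x).
  by rewrite normrZV// unitfE normr_eq0.
exists (`|x| *: c); rewrite lincombZ -xc scalerA divff ?scale1r//.
by rewrite normr_eq0.
Qed.

End CompactUnitBall.

(** * Samuel realcompact Banach spaces *)

Theorem corollary31 (R : realType) (X : completeNormedModType R) :
  samuel_realcompact X <-> finite_dimensional X.
Proof.
split=> [SX|fX].
  exact/compact_unit_ball_finite_dimensional/samuel_realcompact_unit_ball.
exact/samuel_realcompact_compact_balls/finite_dimensional_compact_balls.
Qed.
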